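(* Let $G$ be a finite abelian group and let $M$ be a $\hat G$-linear, left inductive monoid. Fix a non-zero idempotent $e\in M$, let $J=\mathcal J_e$ be its $\mathcal J$-class, and let $G_J=eMe\cap J$. Then: (1) If $V\in\mathrm{Rep}(\hat G_J,\hat G)$ is simple, then $$N(V{\uparrow_e}):=\{x\otimes w\in V{\uparrow_e}\mid eM(x\otimes w)=0\}$$ is the unique maximal subrepresentation of $V{\uparrow_e}$; moreover the simple representation $Q(V)=V{\uparrow_e}/N(V{\uparrow_e})$ has apex $J$, and $Q(V){\downarrow_e}\cong V$ in $\mathrm{Rep}(\hat G_J,\hat G)$. (2) If $V\in\mathrm{Rep}(M,\hat G)$ is simple with apex $J$, then $W=V{\downarrow_e}$ is simple in $\mathrm{Rep}(\hat G_J,\hat G)$, and $W{\uparrow_e}/N(W{\uparrow_e})\cong V$ in $\mathrm{Rep}(M,\hat G)$. In particular, there is a bijection between isomorphism classes of simple objects of $\mathrm{Rep}(M,\hat G)$ with apex $J$ and isomorphism classes of simple objects of $\mathrm{Rep}(\hat G_J,\hat G)$.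
   Context: $G$ is a finite abelian group written multiplicatively and $\hat G=G\sqcup\{0\}$ is the pointed abelian group obtained by adjoining an absorbing element $0$. The category $\mathrm{Vect}_{\hat G}$ has as objects finite pointed sets $(V,0_V)$ with an action of the monoid $\hat G$ (with $0v=0_V$, $g0_V=0_V$) such that $G$ acts freely on $V\setminus\{0_V\}$; morphisms $f:V\to W$ are maps with $f(0_V)=0_W$, $f(gv)=gf(v)$, and such that $f(v_1)=f(v_2)\neq0_W$ implies $Gv_1=Gv_2$. Subspaces are $G$-stable subsets containing $0$; quotients are $V/W=(V\setminus W)\cup\{0_V\}$. A $\hat G$-linear monoid is a finite monoid $M$ with absorbing element $0_M$ containing $G$ as a subgroup of units, such that each element of $G$ commutes with every element of $M$ and $G$ acts freely by translation on $M\setminus\{0_M\}$. $\mathrm{Rep}(M,\hat G)$ is the category of objects $V$ of $\mathrm{Vect}_{\hat G}$ with a monoid action of $M$ by morphisms of $\mathrm{Vect}_{\hat G}$ such that $0_M$ acts as the zero map and $g\in G\subseteq M$ acts as the scalar $g$; morphisms are $M$-equivariant morphisms of $\mathrm{Vect}_{\hat G}$. Subrepresentations are $M$-stable subspaces; a representation is simple if it is nonzero and has no subrepresentations besides $\{0\}$ and itself. $\mathrm{Ann}_M(V)=\{x\in M: xV=0\}$. For $a\in M$, $J(a)=MaM$; $a,b$ are $\mathcal J$-equivalent if $J(a)=J(b)$, with class $\mathcal J_a$. A $\mathcal J$-class is regular if it contains an idempotent. $I(a)=\{x\in J(a): MxM\neq J(a)\}$, and the principal factor $P(a)$ is $(J(a)\setminus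 I(a))\cup\{0\}$ with product $xy$ if $xy\in J(a)\setminus I(a)$ and $0$ otherwise. $M$ acts on $P(e)$ ($e$ idempotent) by left translation: $m\cdot x=mx$ if $mx\in J(e)\setminus I(e)$, else $0$. $M$ is left inductive if for every idempotent $e$, $P(e)$ with this left translation action is an object of $\mathrm{Rep}(M,\hat G)$. For a $\mathcal J$-class $J$, $I_J=\{x\in M: J\not\subseteq MxM\}$; a regular $\mathcal J$-class $J$ is the apex of $V\in\mathrm{Rep}(M,\hat G)$ if $\mathrm{Ann}_M(V)=I_J$. For an idempotent $e$ with $J=\mathcal J_e$, $G_J=eMe\cap J$ is a group with identity $e$, and $\hat G_J=G_J\sqcup\{0\}$. $\mathrm{Rep}(\hat G_J,\hat G)$ consists of objects $W$ of $\mathrm{Vect}_{\hat G}$ with an action of $\hat G_J$ by morphisms of $\mathrm{Vect}_{\hat G}$, $e$ acting as identity, $0$ as zero, and $ge$ ($g\in G$) acting as the scalar $g$. $P(e)e=\{xe: x\in P(e)\}$ (products in $P(e)$), stable under left translation by $M$ and right multiplication by $G_J$. For $W\in\mathrm{Rep}(\hat G_J,\hat G)$, induction is $W{\uparrow_e}=P(e)e\otimes_{\hat G_J}W$: the set of pairs $x\otimes w$ ($x\in P(e)e$, $w\in W$) modulo the equivalence relation generated by $x\alpha\otimes w=x\otimes\alpha w$ for $\alpha\in\hat G_J$, $gx\otimes w=x\otimes gw$ for $g\in G$, and $x\otimes 0=0\otimes w=0$, with $M$ acting by $a(x\otimes w)=(ax)\otimes w$. Restriction is $V{\downarrow_e}=eV$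 with the induced action of $\hat G_J$. *)

(* Defs.v *)
From HB Require Import structures.
From mathcomp Require Import all_boot all_fingroup.

Set Implicit Arguments.
Unset Strict Implicit.
Unset Printing Implicit Defensive.

Record lmon (gT : finGroupType) := LMon {
  mcar :> finType;
  mmul : mcar -> mcar -> mcar;
  mone : mcar;
  mzero : mcar;
  memb : gT -> mcar }.

(* A finite pointed set with a G-action (the Ghat-action: g acts by pgact g,
   0 acts as the constant map to the base point) and an action of the
   elements of the monoid A (only the action of the relevant elements matters). *)
Record pvect (gT : finGroupType) (A : Type) := PVect {
  pcar :> finType;
  pzero : pcar;
  pgact : gT -> pcar -> pcar;
  pract : A -> pcar -> pcar }.

Arguments mmul {gT} l _ _.
Arguments mone {gT} l.
Arguments mzero {gT} l.
Arguments memb {gT} l _.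
Arguments pzero {gT A} p.
Arguments pgact {gT A} p _ _.
Arguments pract {gT A} p _ _.

Section Defs.
Variable gT : finGroupType.
Variable M : lmon gT.

Local Notation "x ** y" := (mmul M x y) (at level 40, left associativity).
Local Notation mvect := (pvect gT M).

Definition is_lmon : Prop :=
  associative (mmul M) /\
  left_id (mone M) (mmul M) /\ right_id (mone M) (mmul M) /\
  left_zero (mzero M) (mmul M) /\ right_zero (mzero M) (mmul M) /\
  memb M 1%g = mone M /\
  (forall g h, memb M (g * h)%g = memb M g ** memb M h) /\
  injective (memb M) /\
  (forall g m, memb M g ** m = m ** memb M g) /\
  (forall g m, memb M g ** m = m -> m != mzero M -> g = 1%g).

Definition ideal (x : M) : {set M} := [set a ** x ** b | a : mcar M, b : mcar M].
Definition Jclass (a : M) : {set M} := [set x | ideal x == ideal a].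
Definition Iset (a : M) : {set M} := [set x in ideal a | ideal x != ideal a].
Definition Jdiff (a : M) : {set M} := ideal a :\: Iset a.
Definition PF (a : M) : {set M} := mzero M |: Jdiff a.
Definition pprod (a x y : M) : M := if x ** y \in Jdiff a then x ** y else mzero M.
Definition ptrans (a m x : M) : M := if m ** x \in Jdiff a then m ** x else mzero M.
Definition IJ (e : M) : {set M} := [set x | ~~ (Jclass e \subset ideal x)].
Definition GJ (e : M) : {set M} :=
  [set x in [set e ** m ** e | m : mcar M] | x \in Jclass e].
Definition GJhat (e : M) : {set M} := mzero M |: GJ e.
(* P(e)e  (0 = 0e is listed explicitly) *)
Definition Pee (e : M) : {set M} := mzero M |: [set pprod e x e | x in PF e].

Definition is_vect (V : mvect) : Prop :=
  (forall v, pgact V 1%g v = v) /\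
  (forall g h v, pgact V (g * h)%g v = pgact V g (pgact V h v)) /\
  (forall g, pgact V g (pzero V) = pzero V) /\
  (forall g v, pgact V g v = v -> v != pzero V -> g = 1%g).

Definition vmorph (V W : mvect) (f : V -> W) : Prop :=
  f (pzero V) = pzero W /\
  (forall g v, f (pgact V g v) = pgact W g (f v)) /\
  (forall v1 v2, f v1 = f v2 -> f v1 != pzero W -> exists g, v1 = pgact V g v2).

(* representations of a submonoid S (with zero mzero M and identity u) of M
   in which g in G acts through memb g * u.
   Rep(M,Ghat) = is_rep setT (mone M); Rep(Ghat_J,Ghat) = is_rep (GJhat e) e. *)
Definition is_rep (S : {set M}) (u : M) (V : mvect) : Prop :=
  is_vect V /\
  (forall a, a \in S -> vmorph (pract V a)) /\
  (forall v, pract V u v = v) /\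
  (forall v, pract V (mzero M) v = pzero V) /\
  (forall a b v, a \in S -> b \in S -> pract V (a ** b) v = pract V a (pract V b v)) /\
  (forall g v, pract V (memb M g ** u) v = pgact V g v).

Definition RepM (V : mvect) : Prop := is_rep setT (mone M) V.
Definition RepJ (e : M) (V : mvect) : Prop := is_rep (GJhat e) e V.

Definition rmorph (S : {set M}) (V W : mvect) (f : V -> W) : Prop :=
  vmorph f /\ (forall a v, a \in S -> f (pract V a v) = pract W a (f v)).

Definition iso (S : {set M}) (V W : mvect) : Prop :=
  exists f : V -> W, exists h : W -> V,
    rmorph S f /\ rmorph S h /\ cancel f h /\ cancel h f.

Definition subrep (S : {set M}) (V : mvect) (X : {set V}) : Prop :=
  pzero V \in X /\
  (forall g v, v \in X -> pgact V g v \in X) /\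
  (forall a v, a \in S -> v \in X -> pract V a v \in X).

Definition simple (S : {set M}) (V : mvect) : Prop :=
  (exists v : V, v != pzero V) /\
  (forall X : {set V}, subrep S X -> X = [set pzero V] \/ X = setT).

Definition maxsub (S : {set M}) (V : mvect) (X : {set V}) : Prop :=
  subrep S X /\ X != setT /\
  (forall Y : {set V}, subrep S Y -> X \subset Y -> Y != setT -> Y = X).

Definition unique_maxsub (S : {set M}) (V : mvect) (X : {set V}) : Prop :=
  maxsub S X /\ (forall Y : {set V}, maxsub S Y -> Y = X).

Definition ann (V : mvect) : {set M} :=
  [set m | [forall v, pract V m v == pzero V]].

Definition apex (e : M) (V : mvect) : Prop := ann V = IJ e.

Lemma PF0 (a : M) : mzero M \in PF a.
Proof. by rewrite /PF setU11. Qed.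
Definition Pzero (a : M) : {x : M | x \in PF a} := exist _ (mzero M) (PF0 a).
Definition Pact (a m : M) (x : {x : M | x \in PF a}) : {x : M | x \in PF a} :=
  insubd (Pzero a) (ptrans a m (val x)).
Definition Pobj (a : M) : mvect :=
  @PVect gT M {x : M | x \in PF a} (Pzero a) (fun g => @Pact a (memb M g)) (@Pact a).

Definition left_inductive : Prop :=
  forall f : M, f ** f = f -> RepM (Pobj f).

Section Quot.
Variables (V : mvect) (X : {set V}).
Lemma qzero_proof : (pzero V \notin X) || (pzero V == pzero V).
Proof. by rewrite eqxx orbT. Qed.
Definition qcar := {v : V | (v \notin X) || (v == pzero V)}.
Definition qzero : qcar := exist _ (pzero V) qzero_proof.
Definition qproj (v : V) : qcar := insubd qzero v.
Definition qobj : mvect :=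
  @PVect gT M qcar qzero (fun g x => qproj (pgact V g (val x)))
    (fun a x => qproj (pract V a (val x))).
End Quot.

Section Res.
Variables (e : M) (V : mvect).
Definition rcar := {v : V | v \in codom (pract V e)}.
Definition rproj (v : V) : rcar := exist _ (pract V e v) (codom_f _ v).
Definition resobj : mvect :=
  @PVect gT M rcar (rproj (pzero V)) (fun g x => rproj (pgact V g (val x)))
    (fun a x => rproj (pract V a (val x))).
End Res.

(* induction W|^e = P(e)e (x)_{Ghat_J} W *)
Section Ind.
Variables (e : M) (W : mvect).
Definition Dom : {set M * W} := [set p : M * W | p.1 \in Pee e].
Definition zp : M * W := (mzero M, pzero W).
Lemma zp_Dom : zp \in Dom.
Proof. by rewrite /Dom inE /Pee setU11. Qed.
Definition tstep (p q : M * W) : bool :=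
  [&& p \in Dom, q \in Dom &
   [|| [exists a in GJhat e, exists x : mcar M, exists w : W,
          (p == (x, pract W a w)) && (q == (pprod e x a, w))],
       [exists g : gT, exists x : mcar M, exists w : W,
          (p == (x, pgact W g w)) && (q == (memb M g ** x, w))] |
       [exists x : mcar M, exists w : W,
          ((p == (x, pzero W)) || (p == (mzero M, w))) && (q == zp)]]].
Definition tsym (p q : M * W) : bool := tstep p q || tstep q p.
Definition tcls (p : M * W) : {set M * W} := [set q | connect tsym p q].
Definition tclasses : {set {set M * W}} := [set tcls p | p in Dom].
Definition icar := {C : {set M * W} | C \in tclasses}.
Definition izero : icar := exist _ (tcls zp) (imset_f tcls zp_Dom).
Definition imk (p : M * W) : icar := insubd izero (tcls p).
Definition irep (C : icar) : M * W := odflt zp [pick p in val C].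
Definition iact (a : M) (C : icar) : icar :=
  imk (ptrans e a (irep C).1, (irep C).2).
Definition indobj : mvect :=
  @PVect gT M icar izero (fun g => iact (memb M g)) iact.
End Ind.

Definition Nset (e : M) (X : mvect) : {set X} :=
  [set z | [forall m : mcar M, pract X (e ** m) z == pzero X]].

Definition Qobj (e : M) (W : mvect) : mvect :=
  qobj (Nset e (indobj e W)).

End Defs.

(* Main.v *)
Require Import Defs.
From HB Require Import structures.
From mathcomp Require Import all_boot all_fingroup.

(* Finiteness identifies G_J with the units of eMe and the nonzero part of
   P(e)e with L = {x | xe = x and ux = e for some u}, on which G_J acts freely;
   so the nonzero elements of P(e)e (x) W are the G_J-orbits on L x (W \ 0).
   Left inductivity makes M act on them by morphisms.
   Since e(x (x) w) is either 0 or e (x) (ex)w, a subrepresentation of W|^e not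
   contained in N meets e (x) W, hence contains it when W is simple, and so is
   everything.  Conversely, for V simple with apex J and an embedding of W onto
   a part of eV, the evaluation x (x) w |-> xw from W|^e to V has kernel N, is
   onto as V is simple, and is injective off N: two vectors with the same
   nonzero value agree after applying some em that does not kill them, hence
   lie in one G-orbit, and G acts freely on V. *)

Set Implicit Arguments.
Unset Strict Implicit.
Unset Printing Implicit Defensive.

(** * Green's relations at an idempotent *)

Section LinearMonoid.

Variables (gT : finGroupType) (M : lmon gT).
Hypothesis HM : is_lmon M.
Implicit Types (a b m n u v x y z : M) (g h : gT).

Local Notation "x ** y" := (mmul M x y) (at level 40, left associativity).
Local Notation "0" := (mzero M).

Lemma lmon_mulA : associative (mmul M). Proof. by case: HM. Qed.
Lemma lmon_mul1m : left_id (mone M) (mmul M). Proof. by case: HM => _ []. Qed.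
Lemma lmon_mulm1 : right_id (mone M) (mmul M).
Proof. by case: HM => _ [_ []]. Qed.
Lemma lmon_mul0m : left_zero 0 (mmul M).
Proof. by case: HM => _ [_ [_ []]]. Qed.
Lemma lmon_mulm0 : right_zero 0 (mmul M).
Proof. by case: HM => _ [_ [_ [_ []]]]. Qed.
Lemma memb1 : memb M 1%g = mone M.
Proof. by case: HM => _ [_ [_ [_ [_ []]]]]. Qed.
Lemma membM g h : memb M (g * h)%g = memb M g ** memb M h.
Proof. by case: HM => _ [_ [_ [_ [_ [_ []]]]]]. Qed.
Lemma memb_comm g m : memb M g ** m = m ** memb M g.
Proof. by case: HM => _ [_ [_ [_ [_ [_ [_ [_ []]]]]]]]. Qed.
Lemma membVK g m : memb M g^-1 ** (memb M g ** m) = m.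
Proof. by rewrite lmon_mulA -membM mulVg memb1 lmon_mul1m. Qed.

Local Notation mulA := lmon_mulA.
Local Notation mul1m := lmon_mul1m.
Local Notation mulm1 := lmon_mulm1.
Local Notation mul0m := lmon_mul0m.
Local Notation mulm0 := lmon_mulm0.

Lemma idealP x y : reflect (exists a b, y = a ** x ** b) (y \in ideal x).
Proof.
apply: (iffP imset2P) => [[a b _ _ ->]|[a [b ->]]]; first by exists a, b.
by exists a b.
Qed.

Lemma ideal_refl x : x \in ideal x.
Proof. by apply/idealP; exists (mone M), (mone M); rewrite mul1m mulm1. Qed.

Lemma ideal_sub x y : x \in ideal y -> ideal x \subset ideal y.
Proof.
case/idealP=> a [b ->]; apply/subsetP=> z /idealP [c [d ->]].
by apply/idealP; exists (c ** a), (b ** d); rewrite !mulA.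
Qed.

Lemma JclassE x y : (x \in Jclass y) = (x \in ideal y) && (y \in ideal x).
Proof.
rewrite inE; apply/eqP/andP => [E|[xy yx]].
  by rewrite -{1}E {2}E !ideal_refl.
by apply/eqP; rewrite eqEsubset !ideal_sub.
Qed.

(** If [ideal x = ideal a] then [x] lies in J(a) automatically, so removing I(a) leaves exactly the
    J-class. Products in P(a) can thus be tested by membership in [Jclass a]. *)
Lemma Jdiff_Jclass a : Jdiff a = Jclass a.
Proof.
apply/setP=> x; rewrite [RHS]inE !inE.
case xa: (x \in ideal a); first by rewrite negbK andbT.
by rewrite andbF; apply/esym/eqP => E; rewrite -E ideal_refl in xa.
Qed.

Section Idempotent.

Variable e : M.
Hypotheses (ee : e ** e = e) (e0 : e != 0).

Lemma Jclass_notin0 : 0 \notin Jclass e.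
Proof.
rewrite JclassE negb_and orbC; apply/orP; left; apply/idealP => -[a [b]].
by rewrite mulm0 mul0m => E; case/eqP: e0.
Qed.

(** An ideal containing [e] contains J(e), hence the whole J-class of [e]. *)
Lemma IJE x : (x \in IJ e) = (e \notin ideal x).
Proof.
rewrite inE; congr (~~ _); apply/subsetP/idP => [|ex y].
  by apply; rewrite inE.
by rewrite JclassE => /andP [/(subsetP (ideal_sub ex))].
Qed.

(* The map x |-> a x is injective on eM, hence onto eM. *)
Lemma corner_inv_comm u a : e ** u = u -> u ** e = u -> e ** a = a ->
  u ** a = e -> a ** u = e.
Proof.
move=> eu ue ea ua; pose X := [set x | e ** x == x].
have injX : {in X &, injective (mmul M a)}.
  move=> x y; rewrite !inE => /eqP ex /eqP ey /(congr1 (mmul M u)).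
  by rewrite !mulA ua ex ey.
have: mmul M a @: X = X.
  apply/eqP; rewrite eqEcard (card_in_imset injX) leqnn andbT.
  by apply/subsetP => _ /imsetP [x _ ->]; rewrite inE mulA ea.
have: e \in X by rewrite inE ee.
move=> + E; rewrite -E => /imsetP [v]; rewrite inE => /eqP ev eav.
suff -> : u = v by [].
by rewrite -ue eav mulA ua.
Qed.

(* The L-class of e, i.e. the set of nonzero elements of P(e)e. *)
Definition Lclass : {set M} := [set x in Jclass e | x ** e == x].

(** Stability of finite monoids: inside the J-class of [e], being fixed by [e] on the right makes
    [e] a left multiple of [x]. *)
Lemma LclassP x : reflect (x ** e = x /\ exists u, u ** x = e) (x \in Lclass).
Proof.
rewrite inE JclassE; apply: (iffP andP).
  case=> /andP [_ /idealP [a [b E]]] /eqP xe.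
  (* Since [e = a ** x ** b], the element [e ** a ** x] has the right inverse [e ** b ** e] in eMe.
     By finiteness this is also a left inverse, which yields [u]. *)
  split=> //; exists (e ** b ** e ** (e ** a)); rewrite -mulA.
  have eK y : e ** (e ** y) = e ** y by rewrite mulA ee.
  have xK y : x ** (e ** y) = x ** y by rewrite mulA xe.
  apply: corner_inv_comm; rewrite -?mulA ?eK ?ee ?xe ?xK //.
  by rewrite !mulA -(mulA e a x) -(mulA e (a ** x)) -E !ee.
case=> xe [u ux]; rewrite xe eqxx; split=> //; apply/andP; split; apply/idealP.
  by exists x, (mone M); rewrite mulm1 xe.
by exists u, (mone M); rewrite mulm1.
Qed.

Lemma Lclass_e : e \in Lclass.
Proof. by apply/LclassP; split=> //; exists e. Qed.

Lemma Lclass_mulmE m x : x \in Lclass -> (m ** x \in Lclass) = (m ** x \in Jclass e).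
Proof. by rewrite !inE => /andP [_ /eqP xe]; rewrite -mulA xe eqxx andbT. Qed.

Lemma Lclass_neq0 x : x \in Lclass -> x != 0.
Proof.
by rewrite inE => /andP [+ _]; apply: contraTneq => ->; exact: Jclass_notin0.
Qed.

Lemma Lclass_memb g x : x \in Lclass -> memb M g ** x \in Lclass.
Proof.
case/LclassP => xe [u ux]; apply/LclassP; split; first by rewrite -mulA xe.
by exists (u ** memb M g^-1); rewrite -mulA membVK.
Qed.

(** Used contrapositively: if [e] is not in [ideal x], no product passing through [x] reaches the
    L-class. *)
Lemma Lclass_ideal m x y : m ** x ** y \in Lclass -> e \in ideal x.
Proof.
case/LclassP => _ [u ux]; apply/idealP; exists (u ** m), y.
by rewrite -!mulA; rewrite -!mulA in ux.
Qed.

(** Lying in eMe means being fixed by [e] on both sides, and the right side is already part of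
    [Lclass]. *)
Lemma GJE a : (a \in GJ e) = (e ** a == a) && (a \in Lclass).
Proof.
rewrite !inE; apply/andP/and3P => [[/imsetP [m _ ->] ->]|[/eqP ea -> /eqP ae]].
  by rewrite !mulA ee -!mulA ee.
by split=> //; apply/imsetP; exists a => //; rewrite ea ae.
Qed.

Lemma GJ_Lclass a : a \in GJ e -> a \in Lclass.
Proof. by rewrite GJE => /andP []. Qed.

Lemma GJ_mull a : a \in GJ e -> e ** a = a.
Proof. by rewrite GJE => /andP [/eqP]. Qed.

Lemma GJ_mulr a : a \in GJ e -> a ** e = a.
Proof. by move/GJ_Lclass/LclassP => []. Qed.

Lemma GJ_e : e \in GJ e.
Proof. by rewrite GJE ee eqxx Lclass_e. Qed.

Lemma GJ_intro a b : e ** a = a -> a ** e = a -> b ** a = e -> a \in GJ e.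
Proof. by move=> ea ae ba; rewrite GJE ea eqxx; apply/LclassP; split=> //; exists b. Qed.

(** The left inverse of [a] supplied by the L-class, compressed to eMe, remains a left inverse and
    is two-sided by [corner_inv_comm]. *)
Lemma GJ_inv a : a \in GJ e -> exists b, [/\ b \in GJ e, a ** b = e & b ** a = e].
Proof.
move=> aG; have ea := GJ_mull aG; have ae := GJ_mulr aG.
have /LclassP [_ [u ua]] := GJ_Lclass aG.
have E : e ** u ** e ** a = e by rewrite -!mulA ea ua.
have E' : a ** (e ** u ** e) = e.
  by apply: corner_inv_comm; rewrite ?mulA ?ee // -mulA ee.
exists (e ** u ** e); split=> //.
by apply: (GJ_intro (b := a)); rewrite // ?mulA ?ee // -mulA ee.
Qed.

Lemma Lclass_mulr x a : x \in Lclass -> a \in GJ e -> x ** a \in Lclass.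
Proof.
case/LclassP => xe [u ux] aG; have [b [bG ab ba]] := GJ_inv aG.
apply/LclassP; split; first by rewrite -mulA GJ_mulr.
by exists (b ** u); rewrite -mulA (mulA u) ux GJ_mull.
Qed.

Lemma GJ_mul a b : a \in GJ e -> b \in GJ e -> a ** b \in GJ e.
Proof.
move=> aG bG; rewrite GJE mulA (GJ_mull aG) eqxx.
by rewrite Lclass_mulr // GJ_Lclass.
Qed.

Lemma GJ_memb g : memb M g ** e \in GJ e.
Proof. by rewrite GJE Lclass_memb ?Lclass_e // mulA -memb_comm -mulA ee eqxx. Qed.

Lemma Lclass_mulr_free x a : x \in Lclass -> a \in GJ e -> x ** a = x -> a = e.
Proof.
case/LclassP => xe [u ux] aG /(congr1 (mmul M u)).
by rewrite mulA ux GJ_mull.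
Qed.

Lemma Lclass_GJ m x : x \in Lclass -> e ** m ** x \in Lclass -> e ** m ** x \in GJ e.
Proof. by move=> xL ?; rewrite GJE !mulA ee eqxx. Qed.

Lemma GJhatP a : reflect (a = 0 \/ a \in GJ e) (a \in GJhat e).
Proof. by rewrite in_setU1; apply: (iffP predU1P). Qed.

Lemma GJhat0 : 0 \in GJhat e. Proof. by apply/GJhatP; left. Qed.

Lemma GJhat_GJ a : a \in GJ e -> a \in GJhat e.
Proof. by move=> ?; apply/GJhatP; right. Qed.

Lemma PeeP x : reflect (x = 0 \/ x \in Lclass) (x \in Pee e).
Proof.
rewrite in_setU1; apply: (iffP predU1P) => -[->|H]; try by left.
  case/imsetP: H => y _ ->; rewrite /Defs.pprod Jdiff_Jclass.
  case: ifP => [yeJ|_]; [right | by left].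
  by rewrite inE yeJ -mulA ee eqxx.
right; apply/imsetP; exists x; move: H; rewrite inE => /andP [xJ /eqP xe].
  by rewrite in_setU1 Jdiff_Jclass xJ orbT.
by rewrite /Defs.pprod Jdiff_Jclass xe xJ.
Qed.

Lemma ptrans_Lclass m x : x \in Lclass ->
  ptrans e m x = if m ** x \in Lclass then m ** x else 0.
Proof. by move=> xL; rewrite /ptrans Jdiff_Jclass Lclass_mulmE. Qed.

Lemma ptrans0 m : ptrans e m 0 = 0.
Proof. by rewrite /ptrans mulm0; case: ifP. Qed.

Lemma pprodx0 x : Defs.pprod e x 0 = 0.
Proof. by rewrite /Defs.pprod mulm0; case: ifP. Qed.

Lemma pprod0x x : Defs.pprod e 0 x = 0.
Proof. by rewrite /Defs.pprod mul0m; case: ifP. Qed.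

Lemma pprod_Lclass x a : x \in Lclass -> a \in GJ e -> Defs.pprod e x a = x ** a.
Proof.
move=> xL aG; rewrite /Defs.pprod Jdiff_Jclass.
by have := Lclass_mulr xL aG; rewrite inE => /andP [-> _].
Qed.

(** The form in which left inductivity is used: the third morphism condition for the action of [m]
    on P(e), read on elements of the L-class. *)
Lemma left_inductive_Lclass m x y : left_inductive M ->
  x \in Lclass -> y \in Lclass -> m ** x \in Lclass -> m ** x = m ** y ->
  exists g, x = memb M g ** y.
Proof.
move=> LI xL yL mxL mxy.
have LP z : z \in Lclass -> z \in PF e.
  by rewrite in_setU1 Jdiff_Jclass inE => /andP [->]; rewrite orbT.
have ME n z (zL : z \in Lclass) : n ** z \in Lclass ->
    val (Pact n (exist _ z (LP z zL) : Pobj e)) = n ** z.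
  by move=> nzL; rewrite val_insubd /= ptrans_Lclass // nzL LP.
have [_ [/(_ m) + _]] := LI e ee; case=> [|_ [_]]; first by rewrite inE.
move=> /(_ (exist _ x (LP x xL)) (exist _ y (LP y yL))).
case=> [|| g /(congr1 val) /= E].
- by apply: val_inj; rewrite /= !ME // -mxy.
- by rewrite -val_eqE /= ME // Lclass_neq0.
by exists g; rewrite E [LHS]ME // Lclass_memb.
Qed.

End Idempotent.

End LinearMonoid.

(** * Representations and quotients *)

Section Representations.

Variables (gT : finGroupType) (M : lmon gT).
Hypothesis HM : is_lmon M.
Implicit Types (a b m : M) (g h : gT) (V W : pvect gT M).

Local Notation "x ** y" := (mmul M x y) (at level 40, left associativity).
Local Notation "0" := (mzero M).
Local Notation mulA := (lmon_mulA HM).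

Section RepLaws.
Variables (S : {set M}) (u : M) (V : pvect gT M).
Hypothesis RV : is_rep S u V.

Lemma rep_vect : is_vect V. Proof. by case: RV. Qed.
Lemma rep_vmorph a : a \in S -> vmorph (pract V a).
Proof. by move=> aS; case: RV => _ [/(_ a aS)]. Qed.
Lemma rep_actv0 a : a \in S -> pract V a (pzero V) = pzero V.
Proof. by case/rep_vmorph. Qed.
Lemma rep_actG a g v : a \in S -> pract V a (pgact V g v) = pgact V g (pract V a v).
Proof. by case/rep_vmorph => _ []. Qed.
Lemma rep_act_eq a v w : a \in S -> pract V a v = pract V a w ->
  pract V a v != pzero V -> exists g, v = pgact V g w.
Proof. by case/rep_vmorph => _ [_ H]; apply: H. Qed.
Lemma rep_act1 v : pract V u v = v. Proof. by case: RV => _ [_ []]. Qed.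
Lemma rep_act0 v : pract V 0 v = pzero V. Proof. by case: RV => _ [_ [_ []]]. Qed.
Lemma rep_actM a b v : a \in S -> b \in S ->
  pract V (a ** b) v = pract V a (pract V b v).
Proof. by case: RV => _ [_ [_ [_ [H _]]]]; apply: H. Qed.
Lemma rep_memb g v : pract V (memb M g ** u) v = pgact V g v.
Proof. by case: RV => _ [_ [_ [_ [_]]]]. Qed.
End RepLaws.

Section Vect.
Variable V : pvect gT M.
Hypothesis HV : is_vect V.
Lemma vect1 v : pgact V 1%g v = v. Proof. by case: HV. Qed.
Lemma vectM g h v : pgact V (g * h)%g v = pgact V g (pgact V h v).
Proof. by case: HV => _ []. Qed.
Lemma vectv0 g : pgact V g (pzero V) = pzero V.
Proof. by case: HV => _ [_ []]. Qed.
Lemma vect_free g v : pgact V g v = v -> v != pzero V -> g = 1%g.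
Proof. by case: HV => _ [_ [_]]; apply. Qed.
End Vect.

(* The third condition on morphisms is automatic for bijections. *)
Lemma iso_intro (S : {set M}) V W (f : V -> W) : is_vect V -> is_vect W ->
  f (pzero V) = pzero W -> (forall g v, f (pgact V g v) = pgact W g (f v)) ->
  (forall a v, a \in S -> f (pract V a v) = pract W a (f v)) ->
  bijective f -> iso S V W.
Proof.
move=> HV HW f0 fG fS [h fK hK]; exists f, h.
split; [|split]; [split=> //; split=> //; split=> // | | by split].
  by move=> v1 v2 /(can_inj fK) -> _; exists 1%g; rewrite vect1.
have hf x y : f x = y -> h y = x by move=> <-.
split; [split; [|split] |].
- exact: hf.
- by move=> g w; apply: hf; rewrite fG hK.
- by move=> v1 v2 /(can_inj hK) -> _; exists 1%g; rewrite vect1.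
by move=> a w aS; apply: hf; rewrite fS // hK.
Qed.

Lemma iso_sym (S : {set M}) V W : iso S V W -> iso S W V.
Proof. by case=> f [h [? [? []]]]; exists h, f. Qed.

Lemma iso_trans (S : {set M}) V W U : is_vect V -> is_vect U ->
  iso S V W -> iso S W U -> iso S V U.
Proof.
move=> HV HU [f [f' [[[f0 [fG _]] fS] [_ [fK f'K]]]]].
case=> [h [h' [[[h0 [hG _]] hS] [_ [hK h'K]]]]].
apply: (iso_intro (f := h \o f)) => //=.
- by rewrite f0.
- by move=> g v; rewrite fG hG.
- by move=> a v aS; rewrite fS ?hS.
by apply: bij_comp; [exists h' | exists f'].
Qed.

Section RepM.
Variable V : pvect gT M.
Hypothesis RV : RepM V.

Lemma repM_memb g v : pract V (memb M g) v = pgact V g v.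
Proof. by rewrite -(rep_memb RV) (lmon_mulm1 HM). Qed.

Lemma repM_actv0 a : pract V a (pzero V) = pzero V.
Proof. by rewrite (rep_actv0 RV) ?inE. Qed.

Lemma repM_actG a g v : pract V a (pgact V g v) = pgact V g (pract V a v).
Proof. by rewrite (rep_actG RV) ?inE. Qed.

Lemma repM_actM a b v : pract V (a ** b) v = pract V a (pract V b v).
Proof. by rewrite (rep_actM RV) ?inE. Qed.

(** Over [M] the scalar [g] acts as the central element [memb M g]. Apart from freeness, the laws of
    the G-action therefore follow from those of the monoid action. *)
Lemma repM_intro (T : pvect gT M) :
  (forall g, pgact T g =1 pract T (memb M g)) ->
  (forall a, pract T a (pzero T) = pzero T) ->
  (forall v, pract T (mone M) v = v) -> (forall v, pract T 0 v = pzero T) ->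
  (forall a b v, pract T (a ** b) v = pract T a (pract T b v)) ->
  (forall g v, pgact T g v = v -> v != pzero T -> g = 1%g) ->
  (forall a v w, pract T a v = pract T a w -> pract T a v != pzero T ->
     exists g, v = pgact T g w) ->
  RepM T.
Proof.
move=> TG T0 T1 T00 TM Tfree Tinj; split; last split; last split; last split; last split => //.
- split=> [v|]; first by rewrite TG (memb1 HM).
  split=> [g h v|]; first by rewrite !TG (membM HM) TM.
  by split=> // g; rewrite TG T0.
- move=> a _; split=> //; split=> [g v|]; last exact: Tinj.
  by rewrite !TG -!TM (memb_comm HM).
- by [].
- by [].
by move=> g v; rewrite TG (lmon_mulm1 HM).
Qed.

Section Quotient.
Variable X : {set V}.
Hypothesis XV : subrep setT X.

Let X0 : pzero V \in X. Proof. by case: XV. Qed.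
Let XM a v : v \in X -> pract V a v \in X.
Proof. by case: XV => _ [_ H]; apply: H; rewrite inE. Qed.

Lemma val_qproj v : val (qproj X v) = if v \in X then pzero V else v.
Proof.
rewrite val_insubd /=; case: (boolP (v \in X)) => //= vX.
by case: eqP.
Qed.

Lemma qproj_eq0 v : (qproj X v == pzero (qobj X) :> qobj X) = (v \in X).
Proof.
rewrite -val_eqE /= val_qproj; case: ifP => [_|vX]; first by rewrite eqxx.
by apply: contraFF vX => /eqP ->.
Qed.

Lemma qproj0 v : v \in X -> qproj X v = pzero (qobj X) :> qobj X.
Proof. by rewrite -qproj_eq0 => /eqP. Qed.

Lemma qprojK q : qproj X (val q) = q.
Proof.
apply: val_inj; rewrite val_qproj; case: ifP => // qX.
by case: q qX => /= v H vX; move: H; rewrite vX => /eqP.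
Qed.

(** A vector of [X] is replaced by the base point before [a] acts; this is harmless because [a]
    keeps it in [X]. *)
Lemma qproj_act a v : pract (qobj X) a (qproj X v) = qproj X (pract V a v).
Proof.
rewrite /= val_qproj; case: ifP => // vX; rewrite repM_actv0.
by rewrite !qproj0 // XM.
Qed.

Lemma qproj_actG g v : pgact (qobj X) g (qproj X v) = qproj X (pgact V g v).
Proof. by rewrite -repM_memb -qproj_act /= repM_memb. Qed.

Lemma qproj_inj v w : qproj X v = qproj X w -> v \notin X -> v = w.
Proof.
move=> E vX; have: w \notin X by rewrite -qproj_eq0 -E qproj_eq0.
by move/(congr1 val): E; rewrite !val_qproj (negPf vX) => -> /negPf ->.
Qed.

Lemma qobj_RepM : RepM (qobj X).
Proof.
have qact := qproj_act.
apply: repM_intro.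
- by move=> g q /=; rewrite repM_memb.
- by move=> a; rewrite /= repM_actv0 qproj0.
- by move=> q; rewrite /= (rep_act1 RV) qprojK.
- by move=> q; rewrite /= (rep_act0 RV) qproj0.
- by move=> a b q; rewrite -(qprojK q) !qact repM_actM.
- move=> g q; rewrite -(qprojK q) qproj_actG qproj_eq0 => /esym E qX.
  move: (qproj_inj E qX) => /esym /(vect_free (rep_vect RV)); apply.
  by apply: contraNneq qX => ->.
move=> a q r; rewrite -(qprojK q) -(qprojK r) !qact qproj_eq0 => E aX.
have := qproj_inj E aX.
case/(rep_act_eq RV) => [||g vE]; first by rewrite inE.
  by apply: contraNneq aX => ->.
by exists g; rewrite qproj_actG -vE.
Qed.

(** The preimage in [V] of a subrepresentation of the quotient contains [X], so by maximality it is
    [X] or everything. *)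
Lemma qobj_simple : maxsub setT X -> simple setT (qobj X).
Proof.
case=> _ [XT Xmax]; split.
  have [v _ vX] : exists2 v, v \in setT & v \notin X.
    by apply/subsetPn; apply: contra XT; rewrite -subTset.
  by exists (qproj X v); rewrite qproj_eq0.
move=> Y [Y0 [YG YM]]; pose Z := qproj X @^-1: Y.
have ZV : subrep setT Z.
  split; first by rewrite inE qproj0.
  have H a v : v \in Z -> pract V a v \in Z.
    by rewrite !inE -qproj_act; apply: YM; rewrite inE.
  by split=> [g v|a v _]; [rewrite -repM_memb|]; apply: H.
have XZ : X \subset Z.
  by apply/subsetP => v vX; rewrite inE qproj0.
have [ZT|ZT] := eqVneq Z setT; [right|left]; apply/setP => q.
  by move/setP/(_ (val q)): ZT; rewrite !inE qprojK.
have ZX := Xmax Z ZV XZ ZT.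
by move/setP/(_ (val q)): ZX; rewrite !inE qprojK -qproj_eq0 qprojK.
Qed.

End Quotient.
End RepM.

End Representations.

(** * Restriction and induction *)

Section Restriction.

Variables (gT : finGroupType) (M : lmon gT).
Hypothesis HM : is_lmon M.
Variable e : M.
Hypotheses (ee : mmul M e e = e) (e0 : e != mzero M).
Variable V : pvect gT M.
Hypothesis RV : RepM V.

Local Notation "x ** y" := (mmul M x y) (at level 40, left associativity).
Local Notation "0" := (mzero M).

Lemma res_fixed (z : resobj e V) : pract V e (val z) = val z.
Proof. by have /codomP [v ->] := valP z; rewrite -(repM_actM RV) ee. Qed.

Lemma res_mk v : pract V e v = v -> exists z : resobj e V, val z = v.
Proof. by exists (rproj e v). Qed.

Lemma val_resG g (z : resobj e V) : val (pgact (resobj e V) g z) = pgact V g (val z).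
Proof. by rewrite /= (repM_actG RV) res_fixed. Qed.

(** The restriction applies [e] once more after acting, which changes nothing since [e ** a = a] on
    G_J. *)
Lemma val_resM a (z : resobj e V) : a \in GJhat e ->
  val (pract (resobj e V) a z) = pract V a (val z).
Proof.
case/(GJhatP e a) => [->|aG]; first by rewrite /= (rep_act0 RV) (repM_actv0 RV).
by rewrite /= -(repM_actM RV) GJ_mull.
Qed.

Lemma val_res0 : val (pzero (resobj e V)) = pzero V.
Proof. by rewrite /= (repM_actv0 RV). Qed.

Lemma GJhat_mul a b : a \in GJhat e -> b \in GJhat e -> a ** b \in GJhat e.
Proof.
move=> /(GJhatP e a) [->|aG] /(GJhatP e b) [->|bG];
  rewrite ?(lmon_mul0m HM) ?(lmon_mulm0 HM) ?GJhat0 //.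
by apply/GJhat_GJ/GJ_mul.
Qed.

(** Each law is pulled back from [V] along the injective map [val], which commutes with both
    actions. *)
Lemma RepJ_resobj : RepJ e (resobj e V).
Proof.
have HV := rep_vect RV.
have eG : e \in GJhat e by apply/GJhat_GJ/GJ_e.
have gG g : memb M g ** e \in GJhat e by apply/GJhat_GJ/GJ_memb.
have vz z : (val z == pzero V) = (z == pzero (resobj e V)) by rewrite -val_res0.
split; [split; [|split; [|split]] |split; [|split; [|split; [|split]]]].
- by move=> z; apply: val_inj; rewrite val_resG vect1.
- by move=> g h z; apply: val_inj; rewrite !val_resG vectM.
- by move=> g; apply: val_inj; rewrite val_resG val_res0 vectv0.
- by move=> g z /(congr1 val); rewrite val_resG -vz; apply: vect_free.
- move=> a aG; split; [|split].
  + by apply: val_inj; rewrite val_resM // val_res0 repM_actv0.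
  + by move=> g z; apply: val_inj; rewrite !(val_resM, val_resG) // repM_actG.
  + move=> z1 z2 /(congr1 val); rewrite -vz !val_resM // => E.
    case/(rep_act_eq RV _ E) => [|g vE]; first by rewrite inE.
    by exists g; apply: val_inj; rewrite val_resG.
- by move=> z; apply: val_inj; rewrite val_resM // res_fixed.
- by move=> z; apply: val_inj; rewrite val_resM ?GJhat0 // val_res0 (rep_act0 RV).
- by move=> a b z aG bG; apply: val_inj; rewrite !val_resM ?GJhat_mul // (repM_actM RV).
by move=> g z; apply: val_inj; rewrite val_resM // val_resG (repM_actM RV) res_fixed repM_memb.
Qed.

End Restriction.

(** * The tensor product and the induced representation *)

Section Induction.

Variables (gT : finGroupType) (M : lmon gT).
Hypothesis HM : is_lmon M.
Variable e : M.
Hypotheses (ee : mmul M e e = e) (e0 : e != mzero M).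
Variable W : pvect gT M.
Hypothesis RW : RepJ e W.

Local Notation "x ** y" := (mmul M x y) (at level 40, left associativity).
Local Notation "0" := (mzero M).
Local Notation mulA := (lmon_mulA HM).
Implicit Types (p q r : M * W) (x y : M) (w : W).

Let HW : is_vect W. Proof. exact: rep_vect RW. Qed.

Lemma repJ_actv0 a : a \in GJ e -> pract W a (pzero W) = pzero W.
Proof. by move=> aG; rewrite (rep_actv0 RW) ?GJhat_GJ. Qed.

Lemma repJ_actM a b w : a \in GJ e -> b \in GJ e ->
  pract W (a ** b) w = pract W a (pract W b w).
Proof. by move=> aG bG; rewrite (rep_actM RW) ?GJhat_GJ. Qed.

Lemma repJ_act_eq0 a w : a \in GJ e -> (pract W a w == pzero W) = (w == pzero W).
Proof.
move=> aG; apply/eqP/eqP => [|->]; last exact: repJ_actv0.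
have [b [bG _ ba]] := GJ_inv HM ee aG.
by move/(congr1 (pract W b)); rewrite -repJ_actM // ba (rep_act1 RW) repJ_actv0.
Qed.

Definition tnull p := (p.1 == 0) || (p.2 == pzero W).

(* Explicit description of the equivalence relation defining the tensor product:
   the null pairs form one class, the others are orbits of G_J. *)
Definition tequiv p q : bool :=
  tnull p && tnull q ||
  [exists a in GJ e, (q.1 == p.1 ** a) && (p.2 == pract W a q.2)].

Lemma tequivP p q : reflect (tnull p /\ tnull q \/
   exists2 a, a \in GJ e & q.1 = p.1 ** a /\ p.2 = pract W a q.2) (tequiv p q).
Proof.
apply: (iffP orP) => -[].
- by move/andP; left.
- by case/exists_inP => a aG /andP [/eqP ? /eqP ?]; right; exists a.
- by move/andP; left.
by case=> a aG [-> ->]; right; apply/exists_inP; exists a => //; rewrite !eqxx.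
Qed.

Lemma in_Dom p : (p \in Dom e W) = (p.1 \in Pee e). Proof. by rewrite inE. Qed.

Lemma Dom_mule p : p \in Dom e W -> p.1 ** e = p.1.
Proof.
rewrite in_Dom => /(PeeP HM ee) [->|/LclassP []//].
exact: lmon_mul0m.
Qed.

Lemma tequiv_refl p : p \in Dom e W -> tequiv p p.
Proof.
move=> /Dom_mule pe; apply/tequivP; right; exists e; first exact: GJ_e.
by rewrite pe (rep_act1 RW).
Qed.

Lemma tequiv_sym p q : p \in Dom e W -> tequiv p q -> tequiv q p.
Proof.
move=> pD /tequivP [[H1 H2]|[a aG [q1 p2]]]; apply/tequivP; [by left|right].
have [b [bG ab ba]] := GJ_inv HM ee aG; exists b => //.
by rewrite q1 p2 -mulA ab Dom_mule // -repJ_actM // ba (rep_act1 RW).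
Qed.

(** G_J acts by invertible maps on both factors, so no orbit mixes null and non-null pairs. *)
Lemma tequiv_null p q : p \in Dom e W -> tequiv p q -> tnull q -> tnull p.
Proof.
move=> pD /tequivP [[] //|[a aG [q1 p2]]]; rewrite /tnull p2 repJ_act_eq0 //.
case/orP => [/eqP q0|->]; last by rewrite orbT.
have [b [bG ab _]] := GJ_inv HM ee aG.
by rewrite -(Dom_mule pD) -ab mulA -q1 q0 (lmon_mul0m HM) eqxx.
Qed.

Lemma tequiv_trans p q r : p \in Dom e W -> q \in Dom e W ->
  tequiv p q -> tequiv q r -> tequiv p r.
Proof.
move=> pD qD pq qr; have qp := tequiv_sym pD pq.
case/tequivP: (qr) => [[qn rn]|[b bG [r1 q2]]].
  by apply/tequivP; left; rewrite (tequiv_null pD pq qn).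
case/tequivP: (pq) => [[pn qn]|[a aG [q1 p2]]].
  apply/tequivP; left; split=> //; move: qn; rewrite /tnull r1 q2 repJ_act_eq0 //.
  by case/orP=> [/eqP ->|->]; rewrite ?orbT // (lmon_mul0m HM) eqxx.
apply/tequivP; right; exists (a ** b); first exact: GJ_mul.
by rewrite r1 q1 mulA p2 q2 repJ_actM.
Qed.

(** Moving [a] in G_J across the tensor sign is one orbit step, and for [a = 0] both pairs are null.
    Moving a scalar [g] amounts to moving [memb M g ** e], which lies in G_J. The zero relations
    join null pairs. *)
Lemma tstep_tequiv p q : tstep e p q ->
  [/\ p \in Dom e W, q \in Dom e W & tequiv p q].
Proof.
case/and3P => pD qD H; split=> //.
case/or3P: H => [/exists_inP [a aG]|/existsP [g]|] /existsP [x] /existsP [w] /andP [].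
- move=> /eqP E /eqP E'; rewrite {}E in pD *; rewrite {}E' in qD *.
  move/(GJhatP e a): aG => [->|aG].
    by rewrite pprodx0 // (rep_act0 RW) /tequiv /tnull /= !eqxx orbT.
  move: pD; rewrite in_Dom /= => /(PeeP HM ee) [->|xL].
    by rewrite pprod0x // /tequiv /tnull /= eqxx.
  by apply/tequivP; right; exists a => //=; rewrite (pprod_Lclass HM).
- move=> /eqP E /eqP E'; rewrite {}E in pD *.
  have /= xe := Dom_mule pD.
  apply/tequivP; right; exists (memb M g ** e); first exact: GJ_memb.
  by rewrite E' /= (rep_memb RW) mulA -(memb_comm HM) -mulA xe.
move=> /orP H /eqP ->; apply/tequivP; left.
by case: H => /eqP ->; rewrite /tnull !eqxx ?orbT.
Qed.

Lemma connect_tequiv p q : p \in Dom e W -> connect (tsym e (W := W)) p q ->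
  q \in Dom e W /\ tequiv p q.
Proof.
move=> pD /connectP [s]; elim/last_ind: s q => [|s r IH] q /=.
  by move=> _ ->; split=> //; apply: tequiv_refl.
rewrite rcons_path last_rcons => /andP [ps sr] ->.
have [lD pl] := IH _ ps erefl.
case/orP: sr => /tstep_tequiv [H1 H2 H]; split=> //; apply: tequiv_trans pl _ => //.
exact: tequiv_sym.
Qed.

(** Null pairs are each one step from the zero pair. Pairs in a common orbit with first entry in the
    L-class are one step apart. *)
Lemma tequiv_connect p q : p \in Dom e W -> q \in Dom e W -> tequiv p q ->
  connect (tsym e (W := W)) p q.
Proof.
have sym : connect_sym (tsym e (W := W)).
  by apply: sym_connect_sym => x y; rewrite /tsym orbC.
have null r : r \in Dom e W -> tnull r -> connect (tsym e (W := W)) r (zp W).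
  move=> rD rn; apply/connect1/orP; left; apply/and3P; split=> //; first exact: zp_Dom.
  apply/or3P/Or33; apply/existsP; exists r.1; apply/existsP; exists r.2.
  rewrite eqxx andbT; case: r rn {rD} => x w /orP [] /= /eqP ->; rewrite eqxx ?orbT //.
move=> pD qD /tequivP [[pn qn]|[a aG [q1 p2]]].
  by apply: connect_trans (null p pD pn) _; rewrite sym null.
move: (pD); rewrite in_Dom => /(PeeP HM ee) [p0|pL].
  have pn : tnull p by rewrite /tnull p0 eqxx.
  apply: connect_trans (null p pD pn) _; rewrite sym null //.
  by rewrite /tnull q1 p0 (lmon_mul0m HM) eqxx.
apply/connect1/orP; left; apply/and3P; split=> //.
apply/or3P/Or31/exists_inP; exists a; first exact: GJhat_GJ.
apply/existsP; exists p.1; apply/existsP; exists q.2.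
by rewrite (pprod_Lclass HM) // -p2 -q1 -!surjective_pairing !eqxx.
Qed.

Local Notation T := (indobj e W).

Definition tens x w : T := imk e (x, w).

Lemma val_imk p : p \in Dom e W -> val (imk e p) = tcls e p.
Proof. by move=> pD; rewrite val_insubd imset_f. Qed.

Lemma imk_eqP p q : p \in Dom e W -> q \in Dom e W ->
  reflect (imk e p = imk e q) (tequiv p q).
Proof.
move=> pD qD; apply: (iffP idP) => [pq|/(congr1 val)].
  apply: val_inj; rewrite !val_imk //; apply/setP => r; rewrite !inE.
  apply: same_connect; first by apply: sym_connect_sym => x y; rewrite /tsym orbC.
  exact: tequiv_connect.
rewrite !val_imk // => /setP /(_ q); rewrite !inE connect0.
by case/(connect_tequiv pD).
Qed.

Lemma irepP (C : T) : irep C \in Dom e W /\ imk e (irep C) = C.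
Proof.
have /imsetP [p pD E] := valP C.
have CE : C = imk e p by apply: val_inj; rewrite val_imk.
rewrite /irep; case: pickP => [q qC|/(_ p)] /=; last by rewrite E inE connect0.
move: qC; rewrite E inE => /(connect_tequiv pD) [qD pq]; split=> //.
by rewrite CE; apply/imk_eqP => //; apply: tequiv_sym.
Qed.

Lemma Lclass_Dom x w : x \in Lclass e -> (x, w) \in Dom e W.
Proof. by move=> xL; rewrite in_Dom; apply/(PeeP HM ee); right. Qed.

Lemma zero_Dom w : (0, w) \in Dom e W.
Proof. by rewrite in_Dom; apply/(PeeP HM ee); left. Qed.

Lemma tens_eq0 x w : x \in Lclass e -> (tens x w == pzero T) = (w == pzero W).
Proof.
move=> xL; have x0 := Lclass_neq0 HM e0 xL.
have zE : pzero T = imk e (zp W) by apply: val_inj; rewrite val_imk ?zp_Dom.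
have zD := zp_Dom e W.
rewrite zE; apply/eqP/eqP => [/(imk_eqP (Lclass_Dom w xL) zD)|->].
  move/(tequiv_null (Lclass_Dom w xL)); rewrite /tnull /= eqxx => /(_ isT).
  by rewrite (negPf x0) => /eqP.
by apply/(imk_eqP (Lclass_Dom _ xL) zD)/tequivP; left; rewrite /tnull /= !eqxx orbT.
Qed.

Lemma tens_mulr x a w : x \in Lclass e -> a \in GJ e ->
  tens (x ** a) w = tens x (pract W a w).
Proof.
move=> xL aG; apply/esym/(imk_eqP (Lclass_Dom _ xL)).
  by rewrite Lclass_Dom // Lclass_mulr.
by apply/tequivP; right; exists a.
Qed.

Lemma tens_eq x y w v : x \in Lclass e -> y \in Lclass e ->
  tens x w = tens y v -> w != pzero W ->
  exists2 a, a \in GJ e & y = x ** a /\ w = pract W a v.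
Proof.
move=> xL yL /(imk_eqP (Lclass_Dom _ xL) (Lclass_Dom _ yL)) /tequivP [[+ _]|//] w0.
by rewrite /tnull /= (negPf w0) (negPf (Lclass_neq0 HM e0 xL)).
Qed.

Lemma tensP (z : T) : exists x w, x \in Lclass e /\ z = tens x w.
Proof.
have [pD E] := irepP z; case: (irep z) pD E => x w.
rewrite in_Dom => /(PeeP HM ee) [/= ->|xL] <-; last by exists x, w.
(* A class whose representative has first entry 0 is the zero class, which is also [e (x) 0]; so the
   first factor can always be taken in the L-class. *)
exists e, (pzero W); have eL := Lclass_e HM ee; split=> //.
apply/imk_eqP; rewrite ?zero_Dom ?Lclass_Dom //.
by rewrite /tequiv /tnull /= !eqxx orbT.
Qed.

(** The action is defined through the chosen representative [irep]. It does not depend on that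
    choice, because right multiplication by G_J preserves whether [m ** x] stays in the L-class. *)
Lemma act_tens m x w : x \in Lclass e ->
  pract T m (tens x w) = if m ** x \in Lclass e then tens (m ** x) w else pzero T.
Proof.
move=> xL; rewrite [LHS]/= /iact; have xD := Lclass_Dom w xL.
have [rD /(imk_eqP rD xD)] := irepP (tens x w).
case: (irep _) rD => y v; rewrite in_Dom /= => /(PeeP HM ee) yP yx.
have zE : pzero T = imk e (zp W) by apply: val_inj; rewrite val_imk ?zp_Dom.
have nullE y' v' : y' \in Pee e -> tnull (y', v') -> imk e (y', v') = pzero T.
  move=> yD yn; rewrite zE; apply/imk_eqP; rewrite ?zero_Dom // ?in_Dom //.
  by apply/tequivP; left; rewrite yn /tnull /= eqxx.
have pP : ptrans e m y \in Pee e.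
  case: yP => [->|yL]; first by rewrite ptrans0 ?in_setU1 ?eqxx.
  rewrite ptrans_Lclass //; case: ifP => [H|_]; last by rewrite in_setU1 eqxx.
  by apply/(PeeP HM ee); right.
(* Either both pairs are null, and then [w = 0] because [x] is nonzero, or [x = y ** a] and
   [v = a w] with [a] in G_J. *)
case/tequivP: (yx) => [[yn xn]|[a aG /= [xE vE]]].
  have w0 : w = pzero W.
    by move: xn; rewrite /tnull /= (negPf (Lclass_neq0 HM e0 xL)) => /eqP.
  rewrite nullE //; last first.
    by case/orP: yn => /= /eqP ->; rewrite /tnull /= ?ptrans0 // eqxx ?orbT.
  case: ifP => // mxL; apply/esym/eqP; by rewrite tens_eq0 // w0.
case: yP => [y0|yL].
  by case/negP: (Lclass_neq0 HM e0 xL); rewrite xE y0 (lmon_mul0m HM).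
have [b [bG ab ba]] := GJ_inv HM ee aG.
have mE : (m ** x \in Lclass e) = (m ** y \in Lclass e).
  apply/idP/idP => [H|H]; last by rewrite xE mulA Lclass_mulr.
  have := Lclass_mulr HM ee H bG.
  by rewrite xE -!mulA ab; case/LclassP: (yL) => // ->.
rewrite ptrans_Lclass // mE; case: ifP => myL; last first.
  by rewrite nullE // /tnull /= ?eqxx // in_setU1 eqxx.
by rewrite xE vE mulA tens_mulr.
Qed.

Lemma ind_act_zero m : pract T m (pzero T) = pzero T.
Proof.
have eL := Lclass_e HM ee; have := act_tens m (pzero W) eL.
have -> : tens e (pzero W) = pzero T by apply/eqP; rewrite tens_eq0.
by move=> ->; case: ifP => // mL; apply/eqP; rewrite tens_eq0.
Qed.

Hypothesis LI : left_inductive M.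

Lemma indobj_RepM : RepM T.
Proof.
apply: (repM_intro HM).
- by [].
- exact: ind_act_zero.
- move=> z; have [x [w [xL ->]]] := tensP z.
  by rewrite act_tens // (lmon_mul1m HM) xL.
- move=> z; have [x [w [xL ->]]] := tensP z.
  rewrite act_tens // (lmon_mul0m HM); case: ifP => // /(Lclass_neq0 HM e0).
  by rewrite eqxx.
- move=> a b z; have [x [w [xL ->]]] := tensP z.
  rewrite !act_tens // -mulA; case: (boolP (b ** x \in Lclass e)) => bL.
    by rewrite act_tens.
  rewrite ind_act_zero; case: ifP => // abL; case/negP: bL.
  (* If [a ** b ** x] has a left multiple equal to [e], so does [b ** x]: the action cannot return
     to the L-class once it has left it. *)
  apply/LclassP => //; split; first by rewrite -mulA; case/LclassP: xL => // ->.
  by case/LclassP: abL => // _ [u]; rewrite mulA; exists (u ** a).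
- move=> g z; have [x [w [xL ->]]] := tensP z.
  have gL := Lclass_memb HM ee g xL.
  rewrite [pgact _ _ _](act_tens (memb M g)) // gL tens_eq0 // => /esym E w0.
  have [a aG [xE wE]] := tens_eq xL gL E w0.
  have xe : x ** e = x by case/LclassP: xL.
  (* Both elements carry [x] to [memb M g ** x], and G_J acts freely on the L-class. Hence [g]
     itself fixes the nonzero [w]. *)
  have aE : memb M g ** e = a.
    have [b [bG ab ba]] := GJ_inv HM ee aG.
    have : x ** (memb M g ** e ** b) = x.
      by rewrite !mulA -(memb_comm HM) -(mulA _ x) xe xE -mulA ab xe.
    move/(Lclass_mulr_free HM ee xL); rewrite GJ_mul ?GJ_memb // => /(_ isT).
    move/(congr1 (mmul M ^~ a)); rewrite -mulA ba -mulA ee => ->.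
    by rewrite GJ_mull.
  by move: wE; rewrite -aE (rep_memb RW) => /esym /(vect_free HW); apply.
move=> m z z'; have [x [w [xL ->]]] := tensP z; have [y [v [yL ->]]] := tensP z'.
rewrite !act_tens //; case: ifP => mxL; last by rewrite eqxx.
case: ifP => myL; last by move=> ->; rewrite eqxx.
rewrite tens_eq0 // => E w0.
have [a aG [myE wE]] := tens_eq mxL myL E w0.
(* The elements [x ** a] and [y] have the same image under [m], so left inductivity puts them in one
   G-orbit; then [x (x) w = x ** a (x) v = g (y (x) v)]. *)
have [g gE] : exists g, x ** a = memb M g ** y.
  have mE : m ** (x ** a) = m ** y by rewrite mulA myE.
  apply: (left_inductive_Lclass HM ee e0 LI _ yL _ mE); first exact: Lclass_mulr.
  by rewrite mE.
exists g; rewrite [RHS](act_tens (memb M g)) // Lclass_memb //.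
by rewrite wE -tens_mulr // gE.
Qed.

End Induction.

(** * Simple representations with a given apex *)

Section Apex.

Variables (gT : finGroupType) (M : lmon gT).
Hypothesis HM : is_lmon M.
Hypothesis LI : left_inductive M.
Variable e : M.
Hypotheses (ee : mmul M e e = e) (e0 : e != mzero M).

Local Notation "x ** y" := (mmul M x y) (at level 40, left associativity).
Local Notation "0" := (mzero M).
Local Notation mulA := (lmon_mulA HM).

Lemma inj_surj_bij (T1 T2 : finType) (f : T1 -> T2) :
  injective f -> (forall y, exists x, f x = y) -> bijective f.
Proof. by move=> fI /fin_all_exists [h hK]; exists h => // x; apply: fI. Qed.

Lemma in_Nset (X : pvect gT M) (z : X) :
  reflect (forall m, pract X (e ** m) z = pzero X) (z \in Nset e X).
Proof. by rewrite inE; apply: (iffP forallP) => H m; apply/eqP. Qed.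

(** Stability under [a] holds because [e ** m ** a] is again of the form [e ** m']. *)
Lemma Nset_subrep (X : pvect gT M) : RepM X -> subrep setT (Nset e X).
Proof.
move=> RX; split; first by apply/in_Nset => m; rewrite (repM_actv0 RX).
split=> [g v /in_Nset vN|a v _ /in_Nset vN]; apply/in_Nset => m.
  by rewrite (repM_actG RX) vN (vectv0 (rep_vect RX)).
by rewrite -(repM_actM RX) -mulA vN.
Qed.

(** * The simple quotient of an induced representation *)

Section Induced.

Variable W : pvect gT M.
Hypotheses (RW : RepJ e W) (SW : simple (GJhat e) W).

Local Notation T := (indobj e W).
Local Notation N := (Nset e T).
Local Notation tens := (@tens gT M e W).

Let RT : RepM T. Proof. exact: indobj_RepM. Qed.
Let eL : e \in Lclass e. Proof. exact: Lclass_e. Qed.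

(** When [e ** m ** x] stays in the L-class it lies in G_J, so it can be moved across the tensor
    sign. *)
Lemma act_e_tens m x w : x \in Lclass e -> pract T (e ** m) (tens x w) =
  if e ** m ** x \in Lclass e then tens e (pract W (e ** m ** x) w) else pzero T.
Proof.
move=> xL; rewrite act_tens //; case: ifP => // emxL.
by rewrite -tens_mulr ?(Lclass_GJ HM ee) // !mulA ee.
Qed.

Lemma act_e_tens_e w : pract T e (tens e w) = tens e w.
Proof. by rewrite act_tens // ee eL. Qed.

Lemma tens_e_inj w v : tens e w = tens e v -> w = v.
Proof.
have [->|w0] := eqVneq w (pzero W).
  by move=> /esym E; apply/esym/eqP; rewrite -(tens_eq0 HM ee e0 RW _ eL) E tens_eq0.
move=> /(tens_eq HM ee e0 RW eL eL) /(_ w0) [a aG [aE ->]].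
by rewrite -(GJ_mull HM ee aG) -aE (rep_act1 RW).
Qed.

Lemma tens_e_Nset w : (tens e w \in N) = (w == pzero W).
Proof.
apply/in_Nset/eqP => [/(_ e)|-> m].
  by rewrite ee act_e_tens_e => /eqP; rewrite tens_eq0 // => /eqP.
have /eqP -> : tens e (pzero W) == pzero T by rewrite tens_eq0.
exact: repM_actv0.
Qed.

Lemma subrep_full (Y : {set T}) : subrep setT Y -> ~~ (Y \subset N) -> Y = setT.
Proof.
move=> [Y0 [YG YM]] /subsetPn [z zY /in_Nset zN].
have {}YM a v : v \in Y -> pract T a v \in Y by apply: YM; rewrite inE.
have [w [ewY w0]] : exists w, tens e w \in Y /\ w != pzero W.
  have [m mz] : exists m, pract T (e ** m) z != pzero T.
    by apply/existsP; apply: contra_notT zN => /existsPn H m; apply/eqP/negbNE/H.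
  have [x [w [xL zE]]] := tensP HM ee RW z.
  move: (YM (e ** m) z zY) mz; rewrite zE act_e_tens //.
  case: ifP => [_|_ _]; last by rewrite eqxx.
  by rewrite tens_eq0 // => ? ?; eexists; split; eassumption.
(* The trace of [Y] on [e (x) W] is a subrepresentation of [W]. It contains the nonzero [w], so by
   simplicity it is all of [W]. *)
pose X := [set v | tens e v \in Y].
have XW : subrep (GJhat e) X.
  have tE v : tens e v \in Y -> forall a, a \in GJ e -> tens e (pract W a v) \in Y.
    move=> vY a aG; rewrite -tens_mulr // GJ_mull //.
    by have := YM a _ vY; rewrite act_tens // (GJ_mulr HM ee aG) (GJ_Lclass HM ee aG).
  have t0 : tens e (pzero W) \in Y.
    by have /eqP -> : tens e (pzero W) == pzero T by rewrite tens_eq0.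
  split; first by rewrite inE.
  split=> [g v|a v aG]; rewrite !inE => vY.
    by rewrite -(rep_memb RW); apply: tE => //; apply: GJ_memb.
  by case/(GJhatP e a): aG => [->|aG]; [rewrite (rep_act0 RW) | apply: tE].
have [_ /(_ X XW) [XE|XE]] := SW.
  have : w \in X by rewrite inE.
  by rewrite XE inE (negPf w0).
apply/setP => y; rewrite in_setT; have [x [v [xL ->]]] := tensP HM ee RW y.
have evY : tens e v \in Y by move/setP/(_ v): XE; rewrite !inE.
(* Every tensor is reached from [Y], as [x (x) v = x (e (x) v)]. *)
have xe : x ** e = x by case/LclassP: xL.
by have := YM x _ evY; rewrite act_tens // xe xL.
Qed.

(** By [subrep_full] every proper subrepresentation lies in [N], and [N] is proper because it
    contains no [e (x) w] with [w] nonzero. *)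
Lemma Nset_unique_maxsub : unique_maxsub setT N.
Proof.
have NT : N != setT.
  have [[w w0] _] := SW; apply: contraNneq w0 => /setP /(_ (tens e w)).
  by rewrite in_setT tens_e_Nset.
have NV := Nset_subrep RT.
have max Y : subrep setT Y -> Y != setT -> Y \subset N.
  by move=> YT; apply: contraNT => /(subrep_full YT) ->.
split; first split=> //; first split=> //.
  by move=> Y YT NY YnT; apply/eqP; rewrite eqEsubset NY max.
by move=> Y [YV [YT Ymax]]; apply/esym/Ymax => //; apply: max.
Qed.

Local Notation Q := (Qobj e W).

Lemma Qobj_RepM : RepM Q.
Proof. by apply: qobj_RepM => //; apply: Nset_subrep. Qed.

Lemma Qobj_simple : simple setT Q.
Proof.
by apply: qobj_simple => //; [apply: Nset_subrep | case: Nset_unique_maxsub].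
Qed.

(** If [e = a ** x ** b], then [x] cannot kill the quotient, where [e (x) w] survives. Otherwise no
    [e ** m ** x ** y] is in the L-class, so [x] sends everything into [N]. *)
Lemma Qobj_apex : apex e Q.
Proof.
have NV := Nset_subrep RT; have RQ := Qobj_RepM.
apply/setP => x; rewrite (IJE HM) inE; apply/forallP/idP => [xQ|ex q].
  apply/negP => /idealP [a [b eE]]; have [[w w0] _] := SW; case/negP: w0.
  have wE : tens e w = pract T (a ** x ** b) (tens e w) by rewrite -eE act_e_tens_e.
  rewrite -tens_e_Nset -(qproj_eq0 NV) wE -(qproj_act RT NV) !(repM_actM RQ).
  by rewrite (eqP (xQ _)) (repM_actv0 RQ).
rewrite -(qprojK q) (qproj_act RT NV) (qproj_eq0 NV).
apply/in_Nset => m; have [y [w [yL ->]]] := tensP HM ee RW (val q).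
rewrite -(repM_actM RT) -mulA act_e_tens //; case: ifP => //.
by rewrite (mulA e) => /(Lclass_ideal HM ee); rewrite (negPf ex).
Qed.

(** The isomorphism sends [w] to the class of [e (x) w]. It is injective since [N] meets [e (x) W]
    only in 0, and onto since [e] maps each tensor to 0 or to some [e (x) v]. *)
Lemma res_Qobj_iso : iso (GJhat e) (resobj e Q) W.
Proof.
have RQ := Qobj_RepM; have NV := Nset_subrep RT.
have vW := rep_vect RW; have RJ := RepJ_resobj HM ee RQ.
apply: iso_sym.
pose f w : resobj e Q := rproj e (qproj N (tens e w) : Q).
have fE w : val (f w) = qproj N (tens e w) :> Q.
  exact: etrans (qproj_act RT NV e (tens e w)) (congr1 _ (act_e_tens_e w)).
have t0 : tens e (pzero W) = pzero T by apply/eqP; rewrite tens_eq0.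
have fS a w : a \in GJhat e -> f (pract W a w) = pract (resobj e Q) a (f w).
  move=> aG; apply: val_inj; apply: etrans (fE _) _.
  apply: esym; apply: etrans (val_resM HM ee RQ _ aG) _.
  apply: etrans (congr1 (pract Q a) (fE w)) _.
  apply: etrans (qproj_act RT NV a _) _; apply: esym.
  congr (qproj N _); case/(GJhatP e a): aG => [->|aG].
    by rewrite (rep_act0 RW) (rep_act0 RT).
  by rewrite -tens_mulr // GJ_mull // act_tens // GJ_mulr // (GJ_Lclass HM ee aG).
apply: (iso_intro (f := f) _ _ _ _ fS).
- exact: vW.
- exact: rep_vect RJ.
- by apply: val_inj; rewrite fE t0 (val_res0 e RQ) (qproj0 NV (proj1 NV)).
- move=> g w; rewrite -(rep_memb RW) -(rep_memb RJ); apply: fS.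
  exact/GJhat_GJ/GJ_memb.
apply: inj_surj_bij => [w v /(congr1 val)|z].
  move=> fwv; have E := etrans (esym (fE w)) (etrans fwv (fE v)).
  apply: tens_e_inj.
  have [wN|] := boolP (tens e w \in N); last exact: (qproj_inj NV E).
  move: (wN); rewrite -(qproj_eq0 NV) E (qproj_eq0 NV).
  by move: wN; rewrite !tens_e_Nset => /eqP -> /eqP ->.
have := res_fixed ee RQ z; set q := val z => qE.
have [x [w [xL zE]]] := tensP HM ee RW (val q).
suff [v vE] : exists v, qproj N (tens e v) = q :> Q.
  by exists v; apply: val_inj; apply: etrans (fE v) vE.
move: qE; rewrite -(qprojK q) (qproj_act RT NV) zE.
have := act_e_tens (mone M) w xL; rewrite (lmon_mulm1 HM) => ->.
case: ifP => _ <-; first by eexists.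
by exists (pzero W); rewrite t0.
Qed.

End Induced.

Lemma iso_resobj (V V' : pvect gT M) : RepM V -> RepM V' -> iso setT V V' ->
  iso (GJhat e) (resobj e V) (resobj e V').
Proof.
move=> RV RV' [f [h [[[f0 [fG _]] fS] [[_ hS] [fK hK]]]]].
pose F (z : resobj e V) : resobj e V' := rproj e (f (val z)).
have FE z : val (F z) = f (val z) by rewrite /= -fS ?inE // (res_fixed ee RV).
apply: (iso_intro (f := F)).
- exact: rep_vect (RepJ_resobj HM ee RV).
- exact: rep_vect (RepJ_resobj HM ee RV').
- by apply: val_inj; rewrite FE !val_res0.
- by move=> g z; apply: val_inj; rewrite !(val_resG ee, FE) // fG.
- by move=> a z aG; apply: val_inj; rewrite !(val_resM HM ee, FE) // fS ?inE.
apply: inj_surj_bij => [z z' /(congr1 val)|z].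
  by rewrite !FE => /(can_inj fK) /val_inj.
have [y yE] : exists y : resobj e V, val y = h (val z).
  by apply: (@res_mk _ _ e V); rewrite -hS ?inE // (res_fixed ee RV').
by exists y; apply: val_inj; rewrite FE yE hK.
Qed.

(** * Recovering a simple representation from its restriction *)

Section SimpleApex.

Variable V : pvect gT M.
Hypotheses (RV : RepM V) (SV : simple setT V) (AV : apex e V).

(** The orbit Mv is a subrepresentation containing the nonzero vector [v], hence is everything. *)
Lemma simple_span v w : v != pzero V -> exists m, w = pract V m v.
Proof.
move=> v0; have [_ /(_ [set pract V m v | m : mcar M])] := SV; case.
- split; first by apply/imsetP; exists 0 => //; rewrite (rep_act0 RV).
  split=> [g _ /imsetP [m _ ->]|a _ _ /imsetP [m _ ->]]; apply/imsetP.
    by exists (memb M g ** m) => //; rewrite (repM_actM RV) repM_memb.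
  by exists (a ** m) => //; rewrite (repM_actM RV).
- move/setP/(_ v); rewrite inE (negPf v0) => /imsetP; case.
  by exists (mone M); rewrite ?(rep_act1 RV).
by move/setP/(_ w); rewrite in_setT => /imsetP [m]; exists m.
Qed.

Lemma act_notin_ideal x v : e \notin ideal x -> pract V x v = pzero V.
Proof.
by rewrite -(IJE HM) -AV inE => /forallP /(_ v) /eqP.
Qed.

(** Since [x = x ** e] lies in J(e) but not in the J-class, [e] is not in [ideal x], and the apex
    condition makes [x] act as zero. *)
Lemma act_notin_Lclass x v : x ** e = x -> x \notin Lclass e -> pract V x v = pzero V.
Proof.
move=> xe xL; apply: act_notin_ideal; apply: contra xL => ex.
rewrite inE xe eqxx (JclassE HM) ex !andbT; apply/idealP.
by exists x, (mone M); rewrite (lmon_mulm1 HM) xe.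
Qed.

(** By the apex condition [e] does not annihilate [V], and a vector not killed by [e] has the form
    [m v]. *)
Lemma act_e_neq0 v : v != pzero V -> exists m, pract V (e ** m) v != pzero V.
Proof.
move=> v0; have [u ue] : exists u, pract V e u != pzero V.
  apply/existsP; rewrite -negb_forall; apply/negP => H.
  have : e \in ann V by rewrite inE.
  by rewrite AV (IJE HM) (ideal_refl HM).
by have [m mE] := simple_span u v0; exists m; rewrite (repM_actM RV) -mE.
Qed.

Lemma resobj_simple : simple (GJhat e) (resobj e V).
Proof.
have R0 := val_res0 e RV.
split.
  have [[v v0] _] := SV; have [m mv] := act_e_neq0 v0.
  exists (rproj e (pract V m v)); apply: contraNneq mv => /(congr1 val).
  by rewrite R0 /= -(repM_actM RV) => ->.
move=> X [X0 [XG XM]].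
have [XE|/subsetPn [z zX]] := boolP (X \subset [set pzero (resobj e V)]).
  by left; apply/eqP; rewrite eqEsubset XE sub1set.
rewrite inE => z0; right; apply/setP => y; rewrite in_setT.
have vz0 : val z != pzero V by rewrite -R0.
have [m yE] := simple_span (val y) vz0.
(* Both vectors are fixed by [e], so [m] can be replaced by [e ** m ** e], which either lies in G_J
   or kills [V]. *)
have {}yE : val y = pract V (e ** m ** e) (val z).
  by rewrite !(repM_actM RV) !(res_fixed ee RV) -yE (res_fixed ee RV).
have eme : e ** m ** e ** e = e ** m ** e by rewrite -mulA ee.
have [L|L] := boolP (e ** m ** e \in Lclass e); last first.
  suff -> : y = pzero (resobj e V) by [].
  by apply: val_inj; rewrite R0 yE act_notin_Lclass.
have aG : e ** m ** e \in GJhat e.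
  by apply/GJhat_GJ/(Lclass_GJ HM ee) => //; apply: Lclass_e.
suff -> : y = pract (resobj e V) (e ** m ** e) z by apply: XM.
by apply: val_inj; rewrite (val_resM HM ee RV).
Qed.

(** * The evaluation map from the induced representation *)

Section Evaluation.

Variables (W : pvect gT M) (phi : W -> V).
Hypotheses (RW : RepJ e W) (SW : simple (GJhat e) W).
Hypotheses (phi0 : phi (pzero W) = pzero V) (phi_inj : injective phi).
Hypothesis phiS : forall a w, a \in GJ e -> phi (pract W a w) = pract V a (phi w).

Local Notation T := (indobj e W).
Local Notation N := (Nset e T).
Local Notation Q := (Qobj e W).
Local Notation tens := (@tens gT M e W).

Let RT : RepM T. Proof. exact: indobj_RepM. Qed.

(** The map [x (x) w |-> x (phi w)], computed on a chosen representative. Allowing any equivariant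
    injection [phi] covers the case where [W] is the restriction of another representation. *)
Definition teval (z : T) : V := pract V (irep z).1 (phi (irep z).2).

Lemma teval_tens x w : x \in Lclass e -> teval (tens x w) = pract V x (phi w).
Proof.
move=> xL; have xD := Lclass_Dom HM ee w xL.
have [rD /(imk_eqP HM ee RW rD xD)] := irepP HM ee RW (tens x w).
rewrite /teval; case: (irep _) rD => y v yD.
case/tequivP=> [[yn xn]|[a aG /= [-> ->]]]; last first.
  by rewrite (repM_actM RV) phiS.
have nullE y' v' : tnull (y', v') -> pract V y' (phi v') = pzero V.
  case/orP => /= /eqP ->; first exact: (rep_act0 RV).
  by rewrite phi0 (repM_actv0 RV).
by rewrite /= !nullE.
Qed.

(** If [m ** x] leaves the L-class, the tensor becomes zero; correspondingly [m ** x] acts as zero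
    on [V] by the apex condition. *)
Lemma teval_act m z : teval (pract T m z) = pract V m (teval z).
Proof.
have [x [w [xL ->]]] := tensP HM ee RW z; have eL := Lclass_e HM ee.
rewrite teval_tens // -(repM_actM RV) act_tens //; case: (boolP (_ \in _)) => mxL.
  by rewrite teval_tens.
have xe : x ** e = x by case/LclassP: xL.
rewrite act_notin_Lclass // -?mulA ?xe //.
have /eqP <- : tens e (pzero W) == pzero T by rewrite tens_eq0.
by rewrite teval_tens // phi0 (repM_actv0 RV).
Qed.

Lemma teval0 : teval (pzero T) = pzero V.
Proof.
by rewrite -(rep_act0 RT (pzero T)) teval_act (rep_act0 RV).
Qed.

(* The vectors of eT are of the form e (x) w, and phi is injective. *)
Lemma act_e_teval_inj m z z' : teval (pract T (e ** m) z) = teval (pract T (e ** m) z') ->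
  pract T (e ** m) z = pract T (e ** m) z'.
Proof.
have eL := Lclass_e HM ee.
have et y : exists w, pract T (e ** m) y = tens e w.
  have [x [w [xL ->]]] := tensP HM ee RW y; rewrite act_e_tens //.
  case: ifP => _; first by eexists.
  by exists (pzero W); apply/esym/eqP; rewrite tens_eq0.
have phie w : pract V e (phi w) = phi w by rewrite -phiS ?GJ_e // (rep_act1 RW).
have [w ->] := et z; have [w' ->] := et z'.
by rewrite !teval_tens // !phie => /phi_inj ->.
Qed.

(** If [z] evaluates to 0, so does every [e ** m] applied to it, and evaluation is injective on such
    vectors. A nonzero value is not killed by some [e ** m]. *)
Lemma teval_eq0 z : (teval z == pzero V) = (z \in N).
Proof.
apply/eqP/in_Nset => [z0 m|zN].
  rewrite -(repM_actv0 RT (e ** m)); apply: act_e_teval_inj.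
  by rewrite !teval_act z0 teval0.
apply/eqP; apply/negPn/negP => /act_e_neq0 [m].
by rewrite -teval_act zN teval0 eqxx.
Qed.

Lemma teval_inj z z' : teval z = teval z' -> z \notin N -> z = z'.
Proof.
rewrite -teval_eq0 => E z0; have [m mz] := act_e_neq0 z0.
have mE : pract T (e ** m) z = pract T (e ** m) z'.
  by apply: act_e_teval_inj; rewrite !teval_act E.
(* The third morphism condition for [e ** m] gives [z = g z']. The common nonzero value is then
   fixed by [g], and freeness on [V] forces [g = 1]. *)
have [||g zE] := rep_act_eq RT _ mE; first by rewrite inE.
  by apply: contraNneq mz; rewrite -teval_act => ->; rewrite teval0.
suff g1 : g = 1%g by rewrite zE g1 (vect1 (rep_vect RT)).
apply: (vect_free (rep_vect RV) (v := teval z)) => //.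
by rewrite {2}zE -(repM_memb HM RT) teval_act repM_memb // E.
Qed.

Lemma Qobj_iso : iso setT Q V.
Proof.
have NV := Nset_subrep RT; have RQ := Qobj_RepM RW.
pose F (q : Q) : V := teval (val q).
have FE z : F (qproj N z) = teval z.
  rewrite /F (val_qproj N); case: ifP => //; rewrite -teval_eq0 teval0.
  by move/eqP.
have FM a q : F (pract Q a q) = pract V a (F q).
  by rewrite -(qprojK q) (qproj_act RT NV) !FE teval_act.
apply: (iso_intro (f := F)).
- exact: rep_vect RQ.
- exact: rep_vect RV.
- exact: teval0.
- by move=> g q; rewrite -!repM_memb.
- by move=> a q _; apply: FM.
have FI : injective F.
  move=> p q E; have [pN|pN] := boolP (val p \in N).
    move: (pN); rewrite -teval_eq0 [teval _]E teval_eq0 => qN.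
    by rewrite -(qprojK p) -(qprojK q) !(qproj0 NV).
  by apply: val_inj; apply: teval_inj pN.
apply: inj_surj_bij => // v.
have [[w w0] _] := SW; have eL := Lclass_e HM ee.
(* One nonzero value suffices for surjectivity, since it spans the simple [V]. *)
have Fw : F (qproj N (tens e w)) != pzero V by rewrite FE teval_eq0 tens_e_Nset.
by have [m ->] := simple_span v Fw; rewrite -FM; eexists.
Qed.

End Evaluation.

(** Here [phi] is the given isomorphism followed by the inclusion of eV in [V]. The case [V' = V]
    gives the second part, and general [V'] gives injectivity on isomorphism classes. *)
Lemma Qobj_resobj_iso (V' : pvect gT M) : RepM V' -> simple (GJhat e) (resobj e V') ->
  iso (GJhat e) (resobj e V') (resobj e V) -> iso setT (Qobj e (resobj e V')) V.
Proof.
move=> RV' SW [f [h [[[f0 _] fS] [_ [fK _]]]]].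
apply: (@Qobj_iso _ (fun z => val (f z))) => //.
- exact: RepJ_resobj.
- by rewrite f0 val_res0.
- by move=> x y /val_inj /(can_inj fK).
by move=> a w aG; rewrite fS ?(val_resM HM ee) // GJhat_GJ.
Qed.

End SimpleApex.

End Apex.

Theorem theoremA (gT : finGroupType) (M : lmon gT) (e : M) :
  abelian [set: gT] -> is_lmon M -> left_inductive M ->
  mmul M e e = e -> e != mzero M ->
  (* (1) *)
  (forall V : pvect gT M, RepJ e V -> simple (GJhat e) V ->
     RepM (indobj e V) /\
     unique_maxsub setT (Nset e (indobj e V)) /\
     RepM (Qobj e V) /\ simple setT (Qobj e V) /\ apex e (Qobj e V) /\
     RepJ e (resobj e (Qobj e V)) /\
     iso (GJhat e) (resobj e (Qobj e V)) V) /\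
  (* (2) *)
  (forall V : pvect gT M, RepM V -> simple setT V -> apex e V ->
     RepJ e (resobj e V) /\ simple (GJhat e) (resobj e V) /\
     RepM (Qobj e (resobj e V)) /\
     iso setT (Qobj e (resobj e V)) V) /\
  (* bijection on isomorphism classes, induced by V |-> V|e *)
  (forall V V' : pvect gT M, RepM V -> RepM V' -> iso setT V V' ->
     iso (GJhat e) (resobj e V) (resobj e V')) /\
  (forall V V' : pvect gT M,
     RepM V -> simple setT V -> apex e V ->
     RepM V' -> simple setT V' -> apex e V' ->
     iso (GJhat e) (resobj e V) (resobj e V') -> iso setT V V') /\
  (forall W : pvect gT M, RepJ e W -> simple (GJhat e) W ->
     exists V : pvect gT M, RepM V /\ simple setT V /\ apex e V /\
       iso (GJhat e) (resobj e V) W).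
Proof.
move=> _ HM LI ee e0.
have iso_refl V : RepM V -> iso setT V V.
  move=> RV; apply: (iso_intro (f := id)) => //; try exact: rep_vect RV.
  by exists id.
have QV V V' : RepM V -> simple setT V -> apex e V ->
    RepM V' -> simple setT V' -> apex e V' ->
    iso (GJhat e) (resobj e V) (resobj e V') -> iso setT (Qobj e (resobj e V)) V'.
  by move=> RV SV AV RV' SV' AV'; apply: Qobj_resobj_iso => //; apply: resobj_simple.
split; [|split; [|split; [|split]]].
- move=> V RV SV; have RQ : RepM (Qobj e V) by apply: Qobj_RepM.
  split; first exact: indobj_RepM.
  split; first exact: Nset_unique_maxsub.
  split; first exact: RQ.
  split; first exact: Qobj_simple.
  split; first exact: Qobj_apex.
  by split; [apply: RepJ_resobj | apply: res_Qobj_iso].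
- move=> V RV SV AV; have RW := RepJ_resobj HM ee RV.
  split; first exact: RW.
  split; first exact: resobj_simple.
  split; first exact: Qobj_RepM.
  by apply: QV => //; apply: iso_resobj => //; apply: iso_refl.
- by move=> V V'; apply: iso_resobj.
- move=> V V' RV SV AV RV' SV' AV' resE.
  (* Both [V] and [V'] are isomorphic to the simple quotient induced from the restriction of [V]. *)
  apply: (iso_trans (W := Qobj e (resobj e V))).
  + exact: rep_vect RV.
  + exact: rep_vect RV'.
  + by apply/iso_sym/QV => //; apply: iso_resobj => //; apply: iso_refl.
  exact: QV.
move=> W RW SW; exists (Qobj e W).
split; first exact: Qobj_RepM.
split; first exact: Qobj_simple.
by split; [apply: Qobj_apex | apply: res_Qobj_iso].
Qed.
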